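(* Right adjoints preserve limits. Precisely: let $u\colon A\to B$ be a functor of quasi-categories admitting a left adjoint in $\mathrm{qCat}_2$, let $X$ be a simplicial set, and let $k\colon K\to A^X$ be a family of diagrams of shape $X$ in $A$ ($K$ a quasi-category). If a functor $\lim\colon K\to A$ and 2-cell $\lambda\colon c\lim\Rightarrow k$ display $\lim$ as an absolute right lifting of $k$ through the constant diagram functor $c\colon A\to A^X$, then the whiskered 2-cell $u^X\lambda\colon c\,u\lim=u^Xc\lim\Rightarrow u^Xk$ displays $u\lim\colon K\to B$ as an absolute right lifting of $u^Xk\colon K\to B^X$ through $c\colon B\to B^X$.
   Context: A quasi-category is a simplicial set with fillers for all inner horns; functors are simplicial maps between quasi-categories. $\mathrm{qCat}_2$ is the strict 2-category of quasi-categories with hom-categories $\hom'(A,B)=h(B^A)$, where $B^A$ is the internal hom and $h\colon\mathrm{sSet}\to\mathrm{Cat}$ is left adjoint to the nerve. Adjunctions of quasi-categories are adjunctions in $\mathrm{qCat}_2$. The constant diagram functor $c\colon A\to A^X$ is the transpose of the projection $A\times X\to A$. A 2-cell $\lambda\colon f\ell\Rightarrow g$ (with $f\colon B\to A$, $g\colon C\to A$, $\ell\colon C\to B$) displays $\ell$ as an absolute right lifting of $g$ through $f$ if for all $b\colon Y\to B$, $y\colon Y\to C$ and every 2-cell $\chi\colon fb\Rightarrow gy$ there is a unique 2-cell $\zeta\colon b\Rightarrow\ell y$ with $\chi=\lambda y\cdot f\zeta$. A quasi-category $A$ admits limits of the family $k\colon K\to A^X$ if $k$ has an absolute right lifting through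 $c\colon A\to A^X$; the case $K=\Delta^0$ is the notion of limit of a single diagram. *)

(* Defs.v *)
From HB Require Import structures.
From mathcomp Require Import all_boot generic_quotient.
From mathcomp Require Import boolp.

Set Implicit Arguments.
Unset Strict Implicit.
Unset Printing Implicit Defensive.

Declare Scope qcat_scope.
Delimit Scope qcat_scope with qcat.
Local Open Scope quotient_scope.
Local Open Scope qcat_scope.

(* Morphisms [m] -> [n] of the simplex category; [n] = {0, ..., n} is 'I_n.+1. *)
Record delta (m n : nat) := Delta {
  delta_fun :> 'I_m.+1 -> 'I_n.+1;
  delta_homo : {homo delta_fun : i j / i <= j}
}.

Lemma delta_ext m n (f g : delta m n) : f =1 g -> f = g.
Proof.
case: f g => [f fP] [g gP] /= /funext fg; subst g.
by rewrite (Prop_irrelevance fP gP).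
Qed.

Definition delta_id n : delta n n := @Delta n n id (fun _ _ => id).

Definition delta_comp l m n (g : delta m n) (f : delta l m) : delta l n :=
  @Delta l n (fun i => g (f i)) (fun _ _ le_ij => delta_homo g (delta_homo f le_ij)).

Definition delta_const m n (i : 'I_n.+1) : delta m n :=
  @Delta m n (fun _ => i) (fun _ _ _ => leqnn i).

Lemma coface_homo n (i : 'I_n.+2) : {homo lift i : j k / j <= k}.
Proof. by move=> j k; rewrite /= leq_bump2. Qed.

Definition coface n (i : 'I_n.+2) : delta n n.+1 := Delta (@coface_homo n i).

Record sset := SSet {
  simplex :> nat -> Type;
  act : forall m n, delta m n -> simplex n -> simplex m;
  act_id : forall n (x : simplex n), act (delta_id n) x = x;
  act_comp : forall l m n (g : delta m n) (f : delta l m) (x : simplex n),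
    act (delta_comp g f) x = act f (act g x)
}.
Arguments act {s m n}.

Record smap (X Y : sset) := SMap {
  smap_fun :> forall n, X n -> Y n;
  smap_act : forall m n (f : delta m n) (x : X n),
    smap_fun (act f x) = act f (smap_fun x)
}.
Arguments smap_fun {X Y} _ {n}.

Lemma smap_ext X Y (f g : smap X Y) : (forall n (x : X n), f n x = g n x) -> f = g.
Proof.
case: f g => [f fP] [g gP] /= fg.
have {}fg : f = g by apply: functional_extensionality_dep => n; apply: funext.
by subst g; rewrite (Prop_irrelevance fP gP).
Qed.

Definition sid X : smap X X := @SMap X X (fun _ x => x) (fun _ _ _ _ => erefl).

Lemma scomp_act X Y Z (g : smap Y Z) (f : smap X Y) m n (d : delta m n) (x : X n) :
  g _ (f _ (act d x)) = act d (g _ (f _ x)).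
Proof. by rewrite !smap_act. Qed.

Definition scomp X Y Z (g : smap Y Z) (f : smap X Y) : smap X Z :=
  SMap (@scomp_act X Y Z g f).

Notation "g ∘ f" := (scomp g f) (at level 40, left associativity) : qcat_scope.

Lemma scompA X Y Z W (h : smap Z W) (g : smap Y Z) (f : smap X Y) :
  h ∘ (g ∘ f) = h ∘ g ∘ f.
Proof. exact: smap_ext. Qed.

Lemma scomp1s X Y (f : smap X Y) : sid Y ∘ f = f.
Proof. exact: smap_ext. Qed.

Lemma scomps1 X Y (f : smap X Y) : f ∘ sid X = f.
Proof. exact: smap_ext. Qed.

Definition simplex_sset (n : nat) : sset :=
  @SSet (fun m => delta m n) (fun _ _ f x => delta_comp x f)
    (fun _ x => @delta_ext _ _ (delta_comp x (delta_id _)) x (fun=> erefl))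
    (fun _ _ _ _ _ _ => delta_ext (fun=> erefl)).
Notation "Δ[ n ]" := (simplex_sset n) (at level 0, format "Δ[ n ]") : qcat_scope.

Definition simplex_map m n (f : delta m n) : smap Δ[m] Δ[n] :=
  @SMap Δ[m] Δ[n] (fun _ x => delta_comp f x) (fun _ _ _ _ => delta_ext (fun=> erefl)).

(* The horn is the union of the faces opposite to the vertices i != k: a simplex
   of Δ[n] lies in it iff it misses some vertex other than k. *)
Definition in_horn n (k : 'I_n.+1) m (x : Δ[n] m) : Prop :=
  exists2 i, i != k & forall j, x j != i.

Lemma in_horn_act n (k : 'I_n.+1) l m (f : delta l m) (x : Δ[n] m) :
  in_horn k x -> in_horn k (act f x).
Proof. by case=> i ik xi; exists i => // j; exact: xi. Qed.

Definition horn_act n (k : 'I_n.+1) l m (f : delta l m)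
    (x : {x : Δ[n] m | in_horn k x}) : {x : Δ[n] l | in_horn k x} :=
  exist _ (act f (sval x)) (in_horn_act f (svalP x)).

Lemma horn_ext n (k : 'I_n.+1) m (x y : {x : Δ[n] m | in_horn k x}) :
  sval x = sval y -> x = y.
Proof.
by case: x y => [x xP] [y yP] /= e; subst y; rewrite (Prop_irrelevance xP yP).
Qed.

Definition horn n (k : 'I_n.+1) : sset :=
  @SSet (fun m => {x : Δ[n] m | in_horn k x}) (@horn_act n k)
    (fun _ x => @horn_ext n k _ (horn_act _ x) x (act_id (sval x)))
    (fun _ _ _ g f x => @horn_ext n k _ (horn_act _ x) (horn_act f (horn_act g x))
                          (act_comp g f (sval x))).

Definition horn_incl n (k : 'I_n.+1) : smap (horn k) Δ[n] :=
  @SMap (horn k) Δ[n] (fun _ x => sval x) (fun _ _ _ _ => erefl).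

Definition is_quasicategory (A : sset) : Prop :=
  forall n (k : 'I_n.+1), 0 < k < n ->
  forall x : smap (horn k) A, exists y : smap Δ[n] A, y ∘ horn_incl k = x.

Record qcat := QCat { qcat_sset :> sset; qcatP : is_quasicategory qcat_sset }.

Definition sprod (X Y : sset) : sset :=
  @SSet (fun n => X n * Y n)%type (fun _ _ f x => (act f x.1, act f x.2))
    (fun _ x => etrans (congr2 pair (act_id x.1) (act_id x.2)) (esym (surjective_pairing x)))
    (fun _ _ _ g f x => congr2 pair (act_comp g f x.1) (act_comp g f x.2)).
Notation "X × Y" := (sprod X Y) (at level 40, left associativity) : qcat_scope.

Definition sfst X Y : smap (X × Y) X :=
  @SMap (X × Y) X (fun _ x => x.1) (fun _ _ _ _ => erefl).

Definition sprod_map X X' Y Y' (f : smap X X') (g : smap Y Y') :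
    smap (X × Y) (X' × Y') :=
  @SMap (X × Y) (X' × Y') (fun _ x => (f _ x.1, g _ x.2))
    (fun _ _ d x => congr2 pair (smap_act f d x.1) (smap_act g d x.2)).

Lemma exp_id A B n (x : smap (A × Δ[n]) B) :
  x ∘ sprod_map (sid A) (simplex_map (delta_id n)) = x.
Proof.
apply: smap_ext => m [a d] /=; congr (smap_fun x (_, _)); exact: delta_ext.
Qed.

Lemma exp_comp A B l m n (g : delta m n) (f : delta l m) (x : smap (A × Δ[n]) B) :
  x ∘ sprod_map (sid A) (simplex_map (delta_comp g f)) =
  x ∘ sprod_map (sid A) (simplex_map g) ∘ sprod_map (sid A) (simplex_map f).
Proof.
apply: smap_ext => k [a d] /=; congr (smap_fun x (_, _)); exact: delta_ext.
Qed.

(* [exp A B] is B^A. *)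
Definition exp (A B : sset) : sset :=
  @SSet (fun n => smap (A × Δ[n]) B)
    (fun _ _ f x => x ∘ sprod_map (sid A) (simplex_map f))
    (@exp_id A B) (@exp_comp A B).

(* [postcomp X u] is u^X : A^X -> B^X. *)
Definition postcomp X A B (f : smap A B) : smap (exp X A) (exp X B) :=
  @SMap (exp X A) (exp X B) (fun _ x => f ∘ x) (fun _ _ _ _ => scompA _ _ _).

Lemma precomp_act A B Y (b : smap Y A) m n (d : delta m n) (x : exp A B n) :
  act d x ∘ sprod_map b (sid Δ[m]) = act d (x ∘ sprod_map b (sid Δ[n]) : exp Y B n).
Proof. exact: smap_ext. Qed.

Definition precomp A B Y (b : smap Y A) : smap (exp A B) (exp Y B) :=
  @SMap (exp A B) (exp Y B) (fun n x => x ∘ sprod_map b (sid Δ[n]))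
    (@precomp_act A B Y b).

Lemma transpose_subproof A X B (f : smap (A × X) B) n (a : A n)
    l m (d : delta l m) (x : (X × Δ[n]) m) :
  f _ (act (act d x).2 a, (act d x).1) = act d (f _ (act x.2 a, x.1)).
Proof. by rewrite -smap_act /= act_comp. Qed.

Lemma transpose_act A X B (f : smap (A × X) B) m n (d : delta m n) (a : A n) :
  SMap (transpose_subproof f (act d a)) =
  act d (SMap (transpose_subproof f a) : exp X B n).
Proof. by apply: smap_ext => k x /=; rewrite act_comp. Qed.

Definition transpose A X B (f : smap (A × X) B) : smap A (exp X B) :=
  @SMap A (exp X B) (fun n a => SMap (transpose_subproof f a)) (transpose_act f).

Definition const (X A : sset) : smap A (exp X A) := transpose (sfst A X).
Arguments const : clear implicits.

Lemma postcomp_const X A B K (u : smap A B) (l : smap K A) :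
  postcomp X u ∘ (const X A ∘ l) = const X B ∘ (u ∘ l).
Proof. by apply: smap_ext => n a; apply: smap_ext => m x /=; rewrite smap_act. Qed.

Record category := Category {
  obj :> Type;
  hom : obj -> obj -> Type;
  idc : forall x, hom x x;
  compc : forall x y z, hom y z -> hom x y -> hom x z;
  compc1 : forall x y (f : hom x y), compc f (idc x) = f;
  comp1c : forall x y (f : hom x y), compc (idc y) f = f;
  compcA : forall x y z w (h : hom z w) (g : hom y z) (f : hom x y),
    compc h (compc g f) = compc (compc h g) f
}.
Arguments hom {c}.
Arguments idc {c} x.
Arguments compc {c x y z}.

Record functor (C D : category) := Functor {
  fobj :> C -> D;
  fhom : forall x y : C, hom x y -> hom (fobj x) (fobj y);
  fhom_id : forall x, fhom (idc x) = idc (fobj x);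
  fhom_comp : forall x y z (g : hom y z) (f : hom x y),
    fhom (compc g f) = compc (fhom g) (fhom f)
}.
Arguments fhom {C D} _ {x y}.

Definition functor_id C : functor C C :=
  @Functor C C id (fun _ _ f => f) (fun _ => erefl) (fun _ _ _ _ _ => erefl).

Definition functor_comp C D E (G : functor D E) (F : functor C D) : functor C E :=
  @Functor C E (fun x => G (F x)) (fun _ _ f => fhom G (fhom F f))
    (fun x => etrans (congr1 _ (fhom_id F x)) (fhom_id G (F x)))
    (fun _ _ _ g f => etrans (congr1 _ (fhom_comp F g f)) (fhom_comp G _ _)).

Definition hom_cast (C : category) (x x' y y' : C) (ex : x = x') (ey : y = y')
    (f : hom x y) : hom x' y' :=
  match ex in _ = a, ey in _ = b return hom a b with erefl, erefl => f end.

(* Morphisms with varying source and target, to compare them across equalities. *)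
Definition arr (C : category) (x y : C) (f : hom x y) : {p : C * C & hom p.1 p.2} :=
  existT (fun p : C * C => hom p.1 p.2) (x, y) f.

Lemma arr_inj (C : category) (x y : C) (f g : hom x y) : arr f = arr g -> f = g.
Proof.
move=> e; have := projT2_eq e.
by rewrite (Prop_irrelevance (projT1_eq e) (erefl (x, y))).
Qed.

Lemma arr_cast (C : category) (x x' y y' : C) (ex : x = x') (ey : y = y') (f : hom x y) :
  arr (hom_cast ex ey f) = arr f.
Proof. by case: _ / ex; case: _ / ey. Qed.

Lemma arr_comp (C : category) (x y z x' y' z' : C) (g : hom y z) (f : hom x y)
    (g' : hom y' z') (f' : hom x' y') :
  arr g = arr g' -> arr f = arr f' -> arr (compc g f) = arr (compc g' f').
Proof.
move=> eg ef; have [ey ez] : y = y' /\ z = z' by case: (projT1_eq eg).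
have [ex _] : x = x' /\ y = y' by case: (projT1_eq ef).
by subst; rewrite (arr_inj eg) (arr_inj ef).
Qed.

Lemma arr_id (C : category) (x x' : C) : x = x' -> arr (idc x) = arr (idc x').
Proof. by move->. Qed.

Lemma functor_ext C D (F G : functor C D) :
  (forall x y (f : hom x y), arr (fhom F f) = arr (fhom G f)) -> F = G.
Proof.
move=> FG.
have FGo : fobj F = fobj G.
  by apply: funext => x; case: (projT1_eq (FG _ _ (idc x))).
case: F G FGo FG => [F Fh Fi Fc] [G Gh Gi Gc] /= FGo FG; subst G.
have FGh : Fh = Gh.
  apply: functional_extensionality_dep => x.
  apply: functional_extensionality_dep => y.
  by apply: funext => f; apply: arr_inj.
by subst Gh; rewrite (Prop_irrelevance Fi Gi) (Prop_irrelevance Fc Gc).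
Qed.

Lemma functor_arr C D (F G : functor C D) : F = G ->
  forall x y (f : hom x y), arr (fhom F f) = arr (fhom G f).
Proof. by move->. Qed.

Lemma arr_fhom C D (F : functor C D) (x y x' y' : C) (f : hom x y) (g : hom x' y') :
  arr f = arr g -> arr (fhom F f) = arr (fhom F g).
Proof.
by move/(congr1 (fun q : {r : C * C & hom r.1 r.2} => arr (fhom F (projT2 q)))).
Qed.

Definition ordc (n : nat) : category :=
  @Category 'I_n.+1 (fun i j => is_true (i <= j)) (fun i => leqnn i)
    (fun _ _ _ jk ij => leq_trans ij jk)
    (fun _ _ _ => Prop_irrelevance _ _) (fun _ _ _ => Prop_irrelevance _ _)
    (fun _ _ _ _ _ _ _ => Prop_irrelevance _ _).

Lemma ordc_irr n (i j : ordc n) (p q : hom i j) : p = q.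
Proof. exact: (@Prop_irrelevance (i <= j)). Qed.

Definition ordc_map m n (f : delta m n) : functor (ordc m) (ordc n) :=
  @Functor (ordc m) (ordc n) f (fun _ _ ij => delta_homo f ij)
    (fun _ => ordc_irr _ _) (fun _ _ _ _ _ => ordc_irr _ _).

Lemma fhom_ordc n (C : category) (F : functor (ordc n) C) (i j i' j' : ordc n)
    (p : hom i j) (p' : hom i' j') :
  i = i' -> j = j' -> arr (fhom F p) = arr (fhom F p').
Proof. by move=> ei ej; subst; rewrite (ordc_irr p p'). Qed.

Lemma nerve_id (C : category) n (x : functor (ordc n) C) :
  functor_comp x (ordc_map (delta_id n)) = x.
Proof. by apply: functor_ext => i j p; apply: fhom_ordc. Qed.

Lemma nerve_comp (C : category) l m n (g : delta m n) (f : delta l m)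
    (x : functor (ordc n) C) :
  functor_comp x (ordc_map (delta_comp g f)) =
  functor_comp (functor_comp x (ordc_map g)) (ordc_map f).
Proof. by apply: functor_ext => i j p; apply: fhom_ordc. Qed.

Definition nerve (C : category) : sset :=
  @SSet (fun n => functor (ordc n) C) (fun _ _ f x => functor_comp x (ordc_map f))
    (@nerve_id C) (@nerve_comp C).

Lemma nerve_map_act C D (F : functor C D) m n (d : delta m n) (x : nerve C n) :
  functor_comp F (act d x) = act d (functor_comp F x : nerve D n).
Proof. exact: functor_ext. Qed.

Definition nerve_map C D (F : functor C D) : smap (nerve C) (nerve D) :=
  @SMap (nerve C) (nerve D) (fun _ x => functor_comp F x) (@nerve_map_act C D F).

(* [hcat X] below is the category presented by the graph of vertices and edges
   of X, where degenerate edges are identities and every 2-simplex is a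
   commutative triangle. That [hcat] is left adjoint to [nerve] is the content
   of [hcat_universal] and [hcat_unit_nat]. *)

Definition src (X : sset) (e : X 1) : X 0 := act (delta_const 0 ord0) e.
Definition tgt (X : sset) (e : X 1) : X 0 := act (delta_const 0 ord_max) e.
Definition degen (X : sset) (x : X 0) : X 1 := act (delta_const 1 ord0) x.
Definition face (X : sset) n (i : 'I_n.+2) (s : X n.+1) : X n := act (coface i) s.

Record edge (X : sset) (x y : X 0) := Edge {
  edge_val :> X 1;
  edge_src : src edge_val = x;
  edge_tgt : tgt edge_val = y
}.

Inductive hterm (X : sset) : X 0 -> X 0 -> Type :=
| HEdge x y : edge x y -> hterm x y
| HId x : hterm x x
| HComp x y z : hterm y z -> hterm x y -> hterm x z.

Inductive hrel (X : sset) : forall x y : X 0, hterm x y -> hterm x y -> Prop :=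
| hrel_refl x y (s : hterm x y) : hrel s s
| hrel_sym x y (s t : hterm x y) : hrel s t -> hrel t s
| hrel_trans x y (s t u : hterm x y) : hrel s t -> hrel t u -> hrel s u
| hrel_comp x y z (s s' : hterm y z) (t t' : hterm x y) :
    hrel s s' -> hrel t t' -> hrel (HComp s t) (HComp s' t')
| hrel_idr x y (s : hterm x y) : hrel (HComp s (HId x)) s
| hrel_idl x y (s : hterm x y) : hrel (HComp (HId y) s) s
| hrel_assoc x y z w (s : hterm z w) (t : hterm y z) (u : hterm x y) :
    hrel (HComp s (HComp t u)) (HComp (HComp s t) u)
| hrel_degen x (e : edge x x) : edge_val e = degen x -> hrel (HEdge e) (HId x)
| hrel_face x y z (f : edge x y) (g : edge y z) (h : edge x z) (s : X 2) :
    face (inord 2) s = f -> face (inord 0) s = g -> face (inord 1) s = h ->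
    hrel (HComp (HEdge g) (HEdge f)) (HEdge h).

Section HomotopyCategory.
Variable X : sset.
Implicit Types x y z : X 0.

Definition hrelb x y : rel {classic hterm x y} := fun s t => `[< hrel s t >].

Lemma hrelb_refl x y : reflexive (@hrelb x y).
Proof. by move=> s; apply/asboolP; exact: hrel_refl. Qed.

Lemma hrelb_sym x y : symmetric (@hrelb x y).
Proof. by move=> s t; apply/asboolP/asboolP; exact: hrel_sym. Qed.

Lemma hrelb_trans x y : transitive (@hrelb x y).
Proof.
by move=> t s u /asboolP st /asboolP tu; apply/asboolP; exact: hrel_trans st tu.
Qed.

Canonical hrel_equiv x y :=
  EquivRel (@hrelb x y) (@hrelb_refl x y) (@hrelb_sym x y) (@hrelb_trans x y).

Definition hhom x y : Type := {eq_quot (hrel_equiv x y)}.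

Definition hclass x y (s : hterm x y) : hhom x y :=
  \pi_{eq_quot (hrel_equiv x y)} (s : {classic hterm x y}).

Definition hrepr x y (f : hhom x y) : hterm x y :=
  repr (f : {eq_quot (hrel_equiv x y)}).

Lemma hreprK x y (f : hhom x y) : hclass (hrepr f) = f.
Proof. exact: (@reprK _ {eq_quot (hrel_equiv x y)}). Qed.

Lemma hclassP x y (s t : hterm x y) : hclass s = hclass t <-> hrel s t.
Proof. by split=> [/eqmodP/asboolP|st] //; apply/eqmodP/asboolP. Qed.

Lemma hclass_surj x y (f : hhom x y) : exists s, f = hclass s.
Proof. by exists (hrepr f); rewrite hreprK. Qed.

Definition hcomp x y z (g : hhom y z) (f : hhom x y) : hhom x z :=
  hclass (HComp (hrepr g) (hrepr f)).

Lemma hcompE x y z (s : hterm y z) (t : hterm x y) :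
  hcomp (hclass s) (hclass t) = hclass (HComp s t).
Proof. by apply/hclassP/hrel_comp; apply/hclassP; rewrite hreprK. Qed.

Lemma hcomp1 x y (f : hhom x y) : hcomp f (hclass (HId x)) = f.
Proof.
by have [s ->] := hclass_surj f; rewrite hcompE; apply/hclassP/hrel_idr.
Qed.

Lemma h1comp x y (f : hhom x y) : hcomp (hclass (HId y)) f = f.
Proof.
by have [s ->] := hclass_surj f; rewrite hcompE; apply/hclassP/hrel_idl.
Qed.

Lemma hcompA x y z w (h : hhom z w) (g : hhom y z) (f : hhom x y) :
  hcomp h (hcomp g f) = hcomp (hcomp h g) f.
Proof.
have [s ->] := hclass_surj h; have [t ->] := hclass_surj g.
by have [u ->] := hclass_surj f; rewrite !hcompE; apply/hclassP/hrel_assoc.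
Qed.

Definition hcat : category :=
  @Category (X 0) hhom (fun x => hclass (HId x)) hcomp hcomp1 h1comp hcompA.

End HomotopyCategory.

Section HLift.
Variables (X : sset) (C : category) (o : X 0 -> C).
Variable ev : forall x y, hterm x y -> hom (o x) (o y).
Hypothesis ev_id : forall x, ev (HId x) = idc (o x).
Hypothesis ev_comp : forall x y z (s : hterm y z) (t : hterm x y),
  ev (HComp s t) = compc (ev s) (ev t).
Hypothesis ev_rel : forall x y (s t : hterm x y), hrel s t -> ev s = ev t.

Lemma ev_repr x y (s : hterm x y) : ev (hrepr (hclass s)) = ev s.
Proof. by apply: ev_rel; apply/hclassP; rewrite hreprK. Qed.

Lemma hlift_id x : ev (hrepr (idc (x : hcat X))) = idc (o x).
Proof. by rewrite ev_repr ev_id. Qed.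

Lemma hlift_comp (x y z : hcat X) (g : hom y z) (f : hom x y) :
  ev (hrepr (compc g f)) = compc (ev (hrepr g)) (ev (hrepr f)).
Proof. by rewrite ev_repr ev_comp. Qed.

Definition hlift : functor (hcat X) C :=
  @Functor (hcat X) C o (fun _ _ f => ev (hrepr f)) hlift_id hlift_comp.

End HLift.

Section HMap.
Variables (X Y : sset) (f : smap X Y).

Lemma edge_map_src x y (e : edge x y) : src (f _ e) = f _ x.
Proof. by rewrite /src -smap_act -[in RHS](edge_src e). Qed.

Lemma edge_map_tgt x y (e : edge x y) : tgt (f _ e) = f _ y.
Proof. by rewrite /tgt -smap_act -[in RHS](edge_tgt e). Qed.

Definition edge_map x y (e : edge x y) : edge (f _ x) (f _ y) :=
  Edge (edge_map_src e) (edge_map_tgt e).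

Fixpoint hterm_map x y (s : hterm x y) : hterm (f _ x) (f _ y) :=
  match s with
  | HEdge _ _ e => HEdge (edge_map e)
  | HId x => HId (f _ x)
  | HComp _ _ _ s t => HComp (hterm_map s) (hterm_map t)
  end.

Lemma hterm_map_rel x y (s t : hterm x y) : hrel s t -> hrel (hterm_map s) (hterm_map t).
Proof.
elim=> {x y s t} /=.
- by move=> *; apply: hrel_refl.
- by move=> *; apply: hrel_sym.
- by move=> x y s t u _ + _; apply: hrel_trans.
- by move=> *; apply: hrel_comp.
- by move=> *; apply: hrel_idr.
- by move=> *; apply: hrel_idl.
- by move=> *; apply: hrel_assoc.
- by move=> x e ex; apply: hrel_degen; rewrite /= ex /degen smap_act.
- move=> x y z a b c s sa sb sc; apply: (@hrel_face _ _ _ _ _ _ _ (f _ s)) => /=.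
  + by rewrite -sa /face smap_act.
  + by rewrite -sb /face smap_act.
  + by rewrite -sc /face smap_act.
Qed.

Definition hmap : functor (hcat X) (hcat Y) :=
  @hlift X (hcat Y) (@smap_fun _ _ f 0) (fun _ _ s => hclass (hterm_map s))
    (fun _ => erefl) (fun _ _ _ _ _ => esym (hcompE _ _))
    (fun _ _ _ _ st => (hclassP _ _).2 (hterm_map_rel st)).

Lemma hmapE x y (s : hterm x y) : fhom hmap (hclass s) = hclass (hterm_map s).
Proof. by apply/hclassP/hterm_map_rel/hclassP; rewrite hreprK. Qed.

End HMap.

Section HUnit.
Variable X : sset.

Lemma dedge_homo n (i j : 'I_n.+1) : i <= j ->
  {homo (fun k : 'I_2 => if k == ord0 then i else j) : k l / k <= l}.
Proof. by move=> ij [[|[]] //= ?] [[|[]] //= ?] _. Qed.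

(* The morphism [1] -> [n] with values i <= j. *)
Definition dedge n (i j : 'I_n.+1) (ij : i <= j) : delta 1 n := Delta (dedge_homo ij).

Definition vertex n (s : X n) (i : 'I_n.+1) : X 0 := act (delta_const 0 i) s.

Lemma spine_src n (s : X n) (i j : 'I_n.+1) (ij : i <= j) :
  src (act (dedge ij) s) = vertex s i.
Proof. by rewrite /src -act_comp; congr act; apply: delta_ext. Qed.

Lemma spine_tgt n (s : X n) (i j : 'I_n.+1) (ij : i <= j) :
  tgt (act (dedge ij) s) = vertex s j.
Proof. by rewrite /tgt -act_comp; congr act; apply: delta_ext. Qed.

Definition spine n (s : X n) (i j : 'I_n.+1) (ij : i <= j) :
    edge (vertex s i) (vertex s j) :=
  Edge (spine_src s ij) (spine_tgt s ij).

Lemma spine_id n (s : X n) (i : 'I_n.+1) (ii : i <= i) :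
  hclass (HEdge (spine s ii)) = hclass (HId (vertex s i)).
Proof.
apply/hclassP/hrel_degen; rewrite /degen /vertex -act_comp /=; congr act.
by apply: delta_ext => k /=; case: ifP.
Qed.

Lemma dtriangle_homo n (i j k : 'I_n.+1) : i <= j -> j <= k ->
  {homo (fun l : 'I_3 => if l == 0 :> nat then i else if l == 1 :> nat then j else k)
    : l m / l <= m}.
Proof.
by move=> ij jk [[|[|[]]] //= ?] [[|[|[]]] //= ?] _ //; exact: leq_trans ij jk.
Qed.

Lemma spine_comp n (s : X n) (i j k : 'I_n.+1) (ij : i <= j) (jk : j <= k) (ik : i <= k) :
  hclass (HEdge (spine s ik)) = hclass (HComp (HEdge (spine s jk)) (HEdge (spine s ij))).
Proof.
apply/esym/hclassP.
apply: (@hrel_face _ _ _ _ _ _ _ (act (Delta (dtriangle_homo ij jk)) s));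
  rewrite /face -act_comp /=; congr act; apply: delta_ext => -[[|[]] //= ?];
  by rewrite /= !inordK.
Qed.

Definition hunit_fun n (s : X n) : nerve (hcat X) n :=
  @Functor (ordc n) (hcat X) (vertex s)
    (fun _ _ ij => hclass (HEdge (spine s ij)))
    (fun _ => spine_id _ _)
    (fun _ _ _ jk ij => etrans (spine_comp s ij jk _) (esym (hcompE _ _))).

Lemma arr_edge (x y x' y' : X 0) (e : edge x y) (e' : edge x' y') :
  edge_val e = edge_val e' ->
  @arr (hcat X) _ _ (hclass (HEdge e)) = @arr (hcat X) _ _ (hclass (HEdge e')).
Proof.
case: e e' => [e sx sy] [e' sx' sy'] /= ee; subst e' x y x' y'.
by [].
Qed.

Lemma hunit_act m n (d : delta m n) (s : X n) :
  hunit_fun (act d s) = act d (hunit_fun s).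
Proof.
apply: functor_ext => i j ij /=; apply: arr_edge => /=; rewrite -act_comp.
by congr act; apply: delta_ext => k /=; case: ifP.
Qed.

Definition hunit : smap X (nerve (hcat X)) := SMap hunit_act.

End HUnit.

Lemma hcat_unit_nat X Y (f : smap X Y) :
  nerve_map (hmap f) ∘ hunit X = hunit Y ∘ f.
Proof.
apply: smap_ext => n s; apply: functor_ext => i j ij.
apply: (etrans (congr1 (@arr (hcat Y) _ _) (hmapE f (HEdge (spine s ij))))).
by apply: arr_edge; rewrite /= smap_act.
Qed.

Section HUniversal.
Variables (X : sset) (C : category) (p : smap X (nerve C)).

Let o (x : X 0) : C := (p _ x : functor (ordc 0) C) ord0.
Let ar (e : X 1) := arr (fhom (p _ e : functor (ordc 1) C)
  (leq0n _ : @hom (ordc 1) ord0 ord_max)).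

Let p_act m n (d : delta m n) (s : X n) (i j : ordc m) (ij : hom i j) :
  arr (fhom (p _ (act d s) : functor (ordc m) C) ij) =
  arr (fhom (p _ s : functor (ordc n) C) (fhom (ordc_map d) ij)).
Proof.
exact: (functor_arr (smap_act p d s : _ = functor_comp (p _ s) (ordc_map d))).
Qed.

Let p_vertex n (s : X n) (i : ordc n) :
  (p _ s : functor (ordc n) C) i = o (act (delta_const 0 i) s).
Proof.
by have /(@projT1_eq _ _ _ _) [] := p_act (delta_const 0 i) s (idc (ord0 : ordc 0)).
Qed.

Let ev_edge x y (e : edge x y) : hom (o x) (o y) :=
  hom_cast (etrans (p_vertex (e : X 1) ord0) (congr1 o (edge_src e)))
           (etrans (p_vertex (e : X 1) ord_max) (congr1 o (edge_tgt e)))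
    (fhom (p _ (e : X 1) : functor (ordc 1) C) (leq0n _ : @hom (ordc 1) ord0 ord_max)).

Let arr_ev x y (e : edge x y) : arr (ev_edge e) = ar e.
Proof. exact: arr_cast. Qed.

Let ar_act n (d : delta 1 n) (s : X n) (i j : ordc n) (ij : hom i j) :
  d ord0 = i -> d ord_max = j ->
  ar (act d s) = arr (fhom (p _ s : functor (ordc n) C) ij).
Proof. by move=> di dj; rewrite /ar p_act; apply: fhom_ordc. Qed.

Fixpoint ev x y (s : hterm x y) : hom (o x) (o y) :=
  match s with
  | HEdge _ _ e => ev_edge e
  | HId x => idc (o x)
  | HComp _ _ _ s t => compc (ev s) (ev t)
  end.

Let ev_rel x y (s t : hterm x y) : hrel s t -> ev s = ev t.
Proof.
elim=> {x y s t} //=.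
- by move=> x y s t u _ -> _ ->.
- by move=> x y z s s' t t' _ -> _ ->.
- by move=> *; rewrite compc1.
- by move=> *; rewrite comp1c.
- by move=> *; rewrite compcA.
- move=> x e ex; apply: arr_inj; rewrite arr_ev ex /degen.
  by rewrite (ar_act _ (idc (ord0 : ordc 0))) // (fhom_id (p _ x : functor _ _)).
- move=> x y z f g h s sf sg sh; apply: arr_inj; rewrite arr_ev -sh /face.
  pose i0 : ordc 2 := inord 0; pose i1 : ordc 2 := inord 1; pose i2 : ordc 2 := inord 2.
  have h01 : hom i0 i1 by rewrite /= /i0 /i1 !inordK.
  have h12 : hom i1 i2 by rewrite /= /i1 /i2 !inordK.
  rewrite (ar_act _ (compc h12 h01)); first last.
  + by apply: val_inj; rewrite /= !inordK.
  + by apply: val_inj; rewrite /= !inordK.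
  rewrite (fhom_comp (p _ s : functor _ _)); apply: arr_comp.
  + rewrite arr_ev -sg /face; apply: ar_act;
    by apply: val_inj; rewrite /= !inordK.
  + rewrite arr_ev -sf /face; apply: ar_act;
    by apply: val_inj; rewrite /= !inordK.
Qed.

Lemma hcat_universal : exists! F : functor (hcat X) C, nerve_map F ∘ hunit X = p.
Proof.
exists (hlift (fun _ => erefl) (fun _ _ _ _ _ => erefl) ev_rel); split.
- apply: smap_ext => n s /=; apply: functor_ext => i j ij /=.
  rewrite (ev_repr ev_rel) /= arr_ev; exact: ar_act.
- move=> G Gp; apply: functor_ext => x y f /=.
  have GE u v (e : edge u v) : arr (fhom G (hclass (HEdge e))) = ar e.
    rewrite /ar -Gp /=; apply: arr_fhom; apply: arr_edge => /=.
    by rewrite -[LHS]act_id; congr act; apply: delta_ext => -[[|[]] //= ?];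
      apply: val_inj.
  have Go u : o u = G u.
    have := GE _ _ (spine (u : X 0) (leqnn (ord0 : 'I_1))).
    move=> /(@projT1_eq _ _ _ _) /= [].
    rewrite /vertex.
    have -> : act (delta_const 0 ord0) u = u.
      by rewrite -[RHS]act_id; congr act; apply: delta_ext => k; rewrite [k]ord1.
    move=> -> _.
    by rewrite (p_vertex (act _ u : X 1) ord0) -act_comp; congr o;
      rewrite -[LHS]act_id; congr act; apply: delta_ext => k; rewrite [k]ord1.
  have [s ->] := hclass_surj f; rewrite (ev_repr ev_rel).
  elim: s => {x y f} [x y e|x|x y z s IHs t IHt] /=.
  + by rewrite arr_ev GE.
  + rewrite -[hclass _]/(idc (x : hcat X)) fhom_id; exact: arr_id.
  + rewrite -hcompE -[hcomp _ _]/(@compc (hcat X) _ _ _ _ _) fhom_comp.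
    exact: arr_comp.
Qed.

End HUniversal.

(* The hom-category hom'(A, B) is [hcat (exp A B)]. Its objects are the maps
   A × Δ[0] -> B, identified through [vtx] with the 1-cells A -> B.

   All of this makes sense for arbitrary simplicial sets, which form a strict
   2-category with the quasi-categories as a full sub-2-category. The 2-cell data
   is therefore defined for simplicial sets; no proof that exponentials A^X of
   quasi-categories are quasi-categories is needed to regard a map into A^X
   as a 1-cell. *)

Definition vtx A B (f : smap A B) : exp A B 0 := f ∘ sfst A Δ[0].

Lemma vtx_bij A B : bijective (@vtx A B).
Proof.
exists (fun x : exp A B 0 => @SMap A B (fun n a => x n (a, delta_const n ord0))
  (fun m n d a => etrans (congr1 (fun q => x m (_, q)) (delta_ext (fun=> erefl)))
                    (smap_act x d (a, delta_const n ord0)))).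
- by move=> f; apply: smap_ext.
- move=> x; apply: smap_ext => n [a d] /=; congr (smap_fun x (_, _)).
  by apply: delta_ext => i; rewrite /= [RHS]ord1.
Qed.

Definition cell A B (f g : smap A B) : Type :=
  @hom (hcat (exp A B)) (vtx f) (vtx g).

Definition cell_id A B (f : smap A B) : cell f f := @idc (hcat (exp A B)) (vtx f).

Definition cell_comp A B (f g h : smap A B) (b : cell g h) (a : cell f g) : cell f h :=
  @compc (hcat (exp A B)) _ _ _ b a.

Definition cell_cast A B (f f' g g' : smap A B) (ef : f = f') (eg : g = g')
    (a : cell f g) : cell f' g' :=
  @hom_cast (hcat (exp A B)) _ _ _ _ (congr1 (@vtx A B) ef) (congr1 (@vtx A B) eg) a.

Lemma vtx_postcomp X A B (u : smap A B) (f : smap X A) :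
  postcomp X u _ (vtx f) = vtx (u ∘ f).
Proof. exact: smap_ext. Qed.

Lemma vtx_precomp A B Y (b : smap Y A) (f : smap A B) :
  precomp B b _ (vtx f) = vtx (f ∘ b).
Proof. exact: smap_ext. Qed.

(* Composites of 1-cells that agree in the strict 2-category are only
   propositionally equal here, e.g. (f g) h and f (g h), or u^X c and c u, so
   2-cells are moved along these equalities by [cell_cast]. The whiskerings are
   the images under the homotopy category functor of u ∘ - : A^X -> B^X and
   - ∘ b : B^A -> B^Y, i.e. horizontal composition with an identity 2-cell. *)
Definition whiskl X A B (u : smap A B) (f g : smap X A) (a : cell f g) :
    cell (u ∘ f) (u ∘ g) :=
  @hom_cast (hcat (exp X B)) _ _ _ _ (vtx_postcomp u f) (vtx_postcomp u g) (fhom (hmap (postcomp X u)) a).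

Definition whiskr A B Y (f g : smap A B) (a : cell f g) (b : smap Y A) :
    cell (f ∘ b) (g ∘ b) :=
  @hom_cast (hcat (exp Y B)) _ _ _ _ (vtx_precomp b f) (vtx_precomp b g) (fhom (hmap (precomp B b)) a).

(* f -| u; the triangle identities are (u ε)(η u) = id and (ε f)(f η) = id. *)
Definition is_adjunction (A B : sset) (f : smap B A) (u : smap A B)
    (eta : cell (sid B) (u ∘ f)) (eps : cell (f ∘ u) (sid A)) : Prop :=
  cell_comp (cell_cast (scompA u f u) (scomps1 u) (whiskl u eps))
            (cell_cast (scomp1s u) erefl (whiskr eta u)) = cell_id u
  /\
  cell_comp (cell_cast (esym (scompA f u f)) (scomp1s f) (whiskr eps f))
            (cell_cast (scomps1 f) erefl (whiskl f eta)) = cell_id f.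

Definition has_left_adjoint (A B : qcat) (u : smap A B) : Prop :=
  exists (f : smap B A) (eta : cell (sid B) (u ∘ f)) (eps : cell (f ∘ u) (sid A)),
    is_adjunction eta eps.

Definition is_absolute_right_lifting (A B C : sset) (f : smap B A) (g : smap C A)
    (l : smap C B) (lambda : cell (f ∘ l) g) : Prop :=
  forall (Y : qcat) (b : smap Y B) (y : smap Y C) (chi : cell (f ∘ b) (g ∘ y)),
  exists! zeta : cell b (l ∘ y),
    chi = cell_comp (whiskr lambda y)
                    (cell_cast erefl (scompA f l y) (whiskl f zeta)).
Arguments is_absolute_right_lifting {A B C} f g l lambda.

(* Main.v *)
(* Transposing maps into A^X to maps out of a product with X, a limit of the
   family k : K -> A^X becomes a universal 2-cell l pr => k' between maps
   K × X -> A, and u^X becomes composition with u. For a fixed source Z,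
   whiskering with f -| u gives a bijection, compatible with restriction along
   maps Y × X -> Y, between 2-cells f b => a and b => u a of maps out of Z; using
   it for Z = Y × X on cones and for Z = Y on the mediating 2-cells transfers the
   universal property from l to u l. The naturality behind this bijection is the
   interchange law for 2-cells.

   Composites of 1-cells agree only propositionally, so 2-cells are compared
   throughout by their underlying arrows with endpoints ([arr], [carr]). *)

Require Import Defs.
From mathcomp Require Import all_boot boolp.

Local Open Scope qcat_scope.

Set Implicit Arguments.
Unset Strict Implicit.
Unset Printing Implicit Defensive.

(** * Casts of morphisms and functoriality of the homotopy category *)

Lemma hom_cast_comp (C : category) (x x' y y' z z' : C) (ex : x = x') (ey : y = y')
    (ez : z = z') (g : hom y z) (f : hom x y) :
  hom_cast ex ez (compc g f) = compc (hom_cast ey ez g) (hom_cast ex ey f).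
Proof. by case: _ / ex; case: _ / ey; case: _ / ez. Qed.

Lemma hom_cast_id (C : category) (x x' : C) (e : x = x') :
  hom_cast e e (idc x) = idc x'.
Proof. by case: _ / e. Qed.

Lemma edge_ext (X : sset) (x y : X 0) (e e' : edge x y) :
  edge_val e = edge_val e' -> e = e'.
Proof.
case: e e' => [e sx sy] [e' sx' sy'] /= ee; subst e'.
by rewrite (Prop_irrelevance sx sx') (Prop_irrelevance sy sy').
Qed.

(** Equality already holds on terms, before passing to classes: the edges on both sides have the
    same underlying 1-simplex and differ only in their endpoint proofs. *)
Lemma hterm_map_comp (X Y Z : sset) (g : smap Y Z) (f : smap X Y) (x y : X 0) (s : hterm x y) :
  hterm_map (g ∘ f) s = hterm_map g (hterm_map f s).
Proof.
elim: s => {x y} //= [x y e|x y z s -> t -> //].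
by congr HEdge; apply: edge_ext.
Qed.

Lemma hmap_comp X Y Z (g : smap Y Z) (f : smap X Y) :
  hmap (g ∘ f) = functor_comp (hmap g) (hmap f).
Proof.
apply: functor_ext => x y a; have [s ->] := hclass_surj a.
rewrite -[fhom (functor_comp _ _) _]/(fhom (hmap g) (fhom (hmap f) _)) !hmapE.
by rewrite hterm_map_comp.
Qed.

Lemma hterm_map_sid (X : sset) (x y : X 0) (s : hterm x y) : hterm_map (sid X) s = s.
Proof.
elim: s => {x y} //= [x y e|x y z s -> t -> //].
by congr HEdge; apply: edge_ext.
Qed.

Lemma hmap_sid X : hmap (sid X) = functor_id (hcat X).
Proof.
apply: functor_ext => x y a; have [s ->] := hclass_surj a.
by rewrite hmapE hterm_map_sid.
Qed.

Lemma arr_hmap_comp X Y Z (g : smap Y Z) (f : smap X Y) (x y : hcat X) (a : hom x y) :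
  arr (fhom (hmap (g ∘ f)) a) = arr (fhom (hmap g) (fhom (hmap f) a)).
Proof. exact: functor_arr (hmap_comp g f) _ _ a. Qed.

Lemma eq_arr_hmap (X Y : sset) (p q : smap X Y) (x y : hcat X) (a : hom x y) :
  p = q -> arr (fhom (hmap p) a) = arr (fhom (hmap q) a).
Proof. by move->. Qed.

(** * Degenerate simplices on a vertex and on an edge *)

Definition degenerate (Z : sset) (z : Z 0) n : Z n := act (delta_const n ord0) z.

Lemma act_degenerate (Z : sset) (z : Z 0) m n (d : delta m n) :
  act d (degenerate z n) = degenerate z m.
Proof. by rewrite /degenerate -act_comp; congr act; apply: delta_ext. Qed.

Lemma degenerate0 (Z : sset) (z : Z 0) : degenerate z 0 = z.
Proof.
by rewrite -[RHS]act_id; congr act; apply: delta_ext => k; rewrite [RHS]ord1.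
Qed.

Lemma hclass_id (Z : sset) (z : Z 0) : hclass (HId z) = @idc (hcat Z) z.
Proof. by []. Qed.

Lemma hclass_comp (Z : sset) (x y z : Z 0) (s : hterm y z) (t : hterm x y) :
  hclass (HComp s t) = @compc (hcat Z) _ _ _ (hclass s) (hclass t).
Proof. by rewrite -hcompE. Qed.

Lemma step_homo n (i : nat) :
  {homo (fun k : 'I_n.+1 => if k <= i then ord0 else ord_max : 'I_2) : j k / j <= k}.
Proof.
move=> j k jk; case: (leqP j i) => // ij.
by rewrite ifN // -ltnNge (leq_trans ij jk).
Qed.

(** For [n = 2] these are the two codegeneracies: [step 2 0] takes the values 0, 1, 1 and [step 2 1]
    the values 0, 0, 1. *)
Definition step n i : delta n 1 := Delta (@step_homo n i).

(** The simplicial identities for the faces of the two degenerate 2-simplices on an edge. Pairing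
    one of them on one edge with the other on a second edge gives the two triangles that fill a
    product square. *)
Lemma act_step (Z : sset) (x y : Z 0) (e : edge x y) :
  [/\ face (inord 0) (act (step 2 0) (edge_val e)) = degenerate y 1,
      face (inord 1) (act (step 2 0) (edge_val e)) = e &
      face (inord 2) (act (step 2 0) (edge_val e)) = e] /\
  [/\ face (inord 0) (act (step 2 1) (edge_val e)) = e,
      face (inord 1) (act (step 2 1) (edge_val e)) = e &
      face (inord 2) (act (step 2 1) (edge_val e)) = degenerate x 1].
Proof.
case: e => e /= sx ty; subst x y.
have coface_step (i : 'I_3) j (d : delta 1 1) :
    (forall k : 'I_2, step 2 j (coface i k) = d k) ->
    face i (act (step 2 j) e) = act d e.
  by move=> dE; rewrite /face -act_comp; congr act; apply: delta_ext.
rewrite /degenerate /src /tgt -!act_comp.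
(* Faces equal to [e] are also put in the form [act d e], so that all six equations become
   comparisons of monotone maps on the two vertices of [1]. *)
have eE : e = act (delta_id 1) e by rewrite act_id.
split; split; (apply: coface_step || (rewrite [RHS]eE; apply: coface_step)) =>
  -[[|[]] //= ?];
  by apply: val_inj; rewrite /= !inordK.
Qed.

(** * Interchange for a simplicial map out of a product *)

Section Bifunctor.
Variables (P Q R : sset) (mu : smap (P × Q) R).

Lemma slicel_act (p : P 0) m n (d : delta m n) (q : Q n) :
  mu m (degenerate p m, act d q) = act d (mu n (degenerate p n, q)).
Proof. by rewrite -smap_act /= act_degenerate. Qed.

(** The restriction of [mu] to the copy of [Q] over the vertex [p]. With [slicer] it yields the two
    partial functors of the bifunctor induced by [mu] on homotopy categories, so no comparison of
    h(P × Q) with hP × hQ is required. *)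
Definition slicel (p : P 0) : smap Q R := SMap (slicel_act p).

Lemma slicer_act (q : Q 0) m n (d : delta m n) (p : P n) :
  mu m (act d p, degenerate q m) = act d (mu n (p, degenerate q n)).
Proof. by rewrite -smap_act /= act_degenerate. Qed.

Definition slicer (q : Q 0) : smap P R := SMap (slicer_act q).

Lemma slicel0 p q : slicel p 0 q = mu 0 (p, q).
Proof. by rewrite /= degenerate0. Qed.

Lemma slicer0 p q : slicer q 0 p = mu 0 (p, q).
Proof. by rewrite /= degenerate0. Qed.

Definition homl p (q q' : hcat Q) (b : hom q q') :
    @hom (hcat R) (mu 0 (p, q)) (mu 0 (p, q')) :=
  @hom_cast (hcat R) _ _ _ _ (slicel0 p q) (slicel0 p q') (fhom (hmap (slicel p)) b).

Definition homr (p p' : hcat P) (a : hom p p') q :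
    @hom (hcat R) (mu 0 (p, q)) (mu 0 (p', q)) :=
  @hom_cast (hcat R) _ _ _ _ (slicer0 p q) (slicer0 p' q) (fhom (hmap (slicer q)) a).

Lemma arr_homl p (q q' : hcat Q) (b : hom q q') :
  arr (homl p b) = arr (fhom (hmap (slicel p)) b).
Proof. exact: (@arr_cast (hcat R)). Qed.

Lemma arr_homr (p p' : hcat P) (a : hom p p') q :
  arr (homr a q) = arr (fhom (hmap (slicer q)) a).
Proof. exact: (@arr_cast (hcat R)). Qed.

Lemma homl_id p (q : hcat Q) : homl p (idc q) = @idc (hcat R) (mu 0 (p, q)).
Proof. by rewrite /homl fhom_id (@hom_cast_id (hcat R)). Qed.

Lemma homl_comp p (q q' q'' : hcat Q) (b : hom q q') (b' : hom q' q'') :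
  homl p (compc b' b) = compc (homl p b') (homl p b).
Proof. by rewrite /homl fhom_comp (@hom_cast_comp (hcat R) _ _ _ _ _ _ _ (slicel0 p q')). Qed.

Lemma homr_id (p : hcat P) q : homr (idc p) q = @idc (hcat R) (mu 0 (p, q)).
Proof. by rewrite /homr fhom_id (@hom_cast_id (hcat R)). Qed.

Lemma homr_comp (p p' p'' : hcat P) (a : hom p p') (a' : hom p' p'') q :
  homr (compc a' a) q = compc (homr a' q) (homr a q).
Proof. by rewrite /homr fhom_comp (@hom_cast_comp (hcat R) _ _ _ _ _ _ _ (slicer0 p' q)). Qed.

Lemma homl_src p (q q' : Q 0) (b : edge q q') :
  src (mu 1 (degenerate p 1, edge_val b)) = mu 0 (p, q).
Proof.
by rewrite /src -smap_act /= act_degenerate degenerate0 -[in RHS](edge_src b).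
Qed.

Lemma homl_tgt p (q q' : Q 0) (b : edge q q') :
  tgt (mu 1 (degenerate p 1, edge_val b)) = mu 0 (p, q').
Proof.
by rewrite /tgt -smap_act /= act_degenerate degenerate0 -[in RHS](edge_tgt b).
Qed.

Lemma homl_edge p (q q' : Q 0) (b : edge q q') :
  homl p (hclass (HEdge b)) = hclass (HEdge (Edge (homl_src p b) (homl_tgt p b))).
Proof.
apply: (@arr_inj (hcat R)); rewrite (@arr_cast (hcat R)) hmapE.
exact: arr_edge.
Qed.

Lemma homr_src (p p' : P 0) (a : edge p p') q :
  src (mu 1 (edge_val a, degenerate q 1)) = mu 0 (p, q).
Proof.
by rewrite /src -smap_act /= act_degenerate degenerate0 -[in RHS](edge_src a).
Qed.

Lemma homr_tgt (p p' : P 0) (a : edge p p') q :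
  tgt (mu 1 (edge_val a, degenerate q 1)) = mu 0 (p', q).
Proof.
by rewrite /tgt -smap_act /= act_degenerate degenerate0 -[in RHS](edge_tgt a).
Qed.

Lemma homr_edge (p p' : P 0) (a : edge p p') q :
  homr (hclass (HEdge a)) q = hclass (HEdge (Edge (homr_src a q) (homr_tgt a q))).
Proof.
apply: (@arr_inj (hcat R)); rewrite (@arr_cast (hcat R)) hmapE.
exact: arr_edge.
Qed.

Lemma diag_src (p p' : P 0) (q q' : Q 0) (a : edge p p') (b : edge q q') :
  src (mu 1 (edge_val a, edge_val b)) = mu 0 (p, q).
Proof. by rewrite /src -smap_act -[in RHS](edge_src a) -[in RHS](edge_src b). Qed.

Lemma diag_tgt (p p' : P 0) (q q' : Q 0) (a : edge p p') (b : edge q q') :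
  tgt (mu 1 (edge_val a, edge_val b)) = mu 0 (p', q').
Proof. by rewrite /tgt -smap_act -[in RHS](edge_tgt a) -[in RHS](edge_tgt b). Qed.

(* Both composites are the diagonal of the square [mu (a, b)], by its two
   nondegenerate 2-simplices. *)
Lemma interchange_edge (p p' : P 0) (q q' : Q 0) (a : edge p p') (b : edge q q') :
  @compc (hcat R) _ _ _ (homl p' (hclass (HEdge b))) (homr (hclass (HEdge a)) q) =
  compc (homr (hclass (HEdge a)) q') (homl p (hclass (HEdge b))).
Proof.
rewrite !homl_edge !homr_edge -!hclass_comp.
have [[a00 a01 a02] [a10 a11 a12]] := act_step a.
have [[b00 b01 b02] [b10 b11 b12]] := act_step b.
pose d := HEdge (Edge (diag_src a b) (diag_tgt a b)).
transitivity (hclass d); [|symmetry]; apply/hclassP.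
- apply: (@hrel_face _ _ _ _ _ _ _
    (mu 2 (act (step 2 0) (edge_val a), act (step 2 1) (edge_val b)))) => /=;
  by rewrite /face -smap_act /=; congr (smap_fun mu (_, _)).
- apply: (@hrel_face _ _ _ _ _ _ _
    (mu 2 (act (step 2 1) (edge_val a), act (step 2 0) (edge_val b)))) => /=;
  by rewrite /face -smap_act /=; congr (smap_fun mu (_, _)).
Qed.

(** Commuting squares paste along both sides, and identities give trivial squares. Induction on a
    term for [a], and then for a single edge on a term for [b], leaves only squares of edges. *)
Lemma interchange (p p' : hcat P) (a : hom p p') (q q' : hcat Q) (b : hom q q') :
  compc (homl p' b) (homr a q) = compc (homr a q') (homl p b).
Proof.
have [s ->] := hclass_surj a; have [t ->] := hclass_surj b.
elim: s q q' t {a b} => {p p'} [p p' a|p|p p' p'' s IHs s' IHs'] q q' t.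
- elim: t => {q q'} [q q' b|q|q q' q'' t IHt t' IHt'].
  + exact: interchange_edge.
  + by rewrite hclass_id !homl_id comp1c compc1.
  + by rewrite hclass_comp !homl_comp -compcA IHt' compcA IHt compcA.
- by rewrite hclass_id !homr_id comp1c compc1.
- by rewrite hclass_comp !homr_comp compcA IHs -[LHS]compcA IHs' compcA.
Qed.

End Bifunctor.

(** * Calculus of 2-cells and whiskering *)

Section Cells.
Implicit Types A B Z Y : sset.

Lemma cell_compA Z A (f g h k : smap Z A) (c : cell h k) (b : cell g h) (a : cell f g) :
  cell_comp c (cell_comp b a) = cell_comp (cell_comp c b) a.
Proof. exact: (@compcA (hcat (exp Z A))). Qed.

Lemma cell_comp1 Z A (f g : smap Z A) (a : cell f g) : cell_comp a (cell_id f) = a.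
Proof. exact: (@compc1 (hcat (exp Z A))). Qed.

Lemma cell_1comp Z A (f g : smap Z A) (a : cell f g) : cell_comp (cell_id g) a = a.
Proof. exact: (@comp1c (hcat (exp Z A))). Qed.

Definition carr Z A (f g : smap Z A) (a : cell f g) := @arr (hcat (exp Z A)) _ _ a.

Lemma carr_inj Z A (f g : smap Z A) (a b : cell f g) : carr a = carr b -> a = b.
Proof. exact: arr_inj. Qed.

Lemma carr_cast Z A (f f' g g' : smap Z A) (ef : f = f') (eg : g = g') (a : cell f g) :
  carr (cell_cast ef eg a) = carr a.
Proof. exact: (@arr_cast (hcat (exp Z A))). Qed.

Lemma carr_comp Z A (f g h f' g' h' : smap Z A) (b : cell g h) (a : cell f g)
    (b' : cell g' h') (a' : cell f' g') :
  carr b = carr b' -> carr a = carr a' -> carr (cell_comp b a) = carr (cell_comp b' a').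
Proof. exact: (@arr_comp (hcat (exp Z A))). Qed.

Lemma carr_whiskl Z A B (u : smap A B) (f g : smap Z A) (a : cell f g) :
  carr (whiskl u a) = arr (fhom (hmap (postcomp Z u)) a).
Proof. exact: (@arr_cast (hcat (exp Z B))). Qed.

Lemma carr_whiskr A B Y (f g : smap A B) (a : cell f g) (b : smap Y A) :
  carr (whiskr a b) = arr (fhom (hmap (precomp B b)) a).
Proof. exact: (@arr_cast (hcat (exp Y B))). Qed.

Lemma eq_carr_whiskl Z A B (u : smap A B) (f g f' g' : smap Z A)
    (a : cell f g) (a' : cell f' g') :
  carr a = carr a' -> carr (whiskl u a) = carr (whiskl u a').
Proof. by rewrite !carr_whiskl; apply: arr_fhom. Qed.

Lemma eq_carr_whiskr A B Y (f g f' g' : smap A B) (a : cell f g) (a' : cell f' g')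
    (b : smap Y A) :
  carr a = carr a' -> carr (whiskr a b) = carr (whiskr a' b).
Proof. by rewrite !carr_whiskr; apply: arr_fhom. Qed.

Lemma whiskr_id A B Y (f : smap A B) (b : smap Y A) :
  whiskr (cell_id f) b = cell_id (f ∘ b).
Proof. by rewrite /whiskr fhom_id; apply: (@hom_cast_id (hcat (exp Y B))). Qed.

Lemma whiskl_comp Z A B (u : smap A B) (f g h : smap Z A) (b : cell g h) (a : cell f g) :
  whiskl u (cell_comp b a) = cell_comp (whiskl u b) (whiskl u a).
Proof. by rewrite /whiskl fhom_comp; apply: (@hom_cast_comp (hcat (exp Z B))). Qed.

Lemma whiskr_comp A B Y (f g h : smap A B) (b : cell g h) (a : cell f g) (y : smap Y A) :
  whiskr (cell_comp b a) y = cell_comp (whiskr b y) (whiskr a y).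
Proof. by rewrite /whiskr fhom_comp; apply: (@hom_cast_comp (hcat (exp Y B))). Qed.

(** Whiskerings are values of [hmap], so this law and the next ones reduce to equalities of
    simplicial maps between exponentials. They are stated with [carr] because the two sides have
    endpoints that are only propositionally equal. *)
Lemma whiskl_whiskl Z A B C (v : smap B C) (u : smap A B) (f g : smap Z A) (a : cell f g) :
  carr (whiskl v (whiskl u a)) = carr (whiskl (v ∘ u) a).
Proof.
rewrite !carr_whiskl (arr_fhom _ (carr_whiskl u a)) -arr_hmap_comp.
by apply: eq_arr_hmap; apply: smap_ext => n x; apply: smap_ext.
Qed.

Lemma whiskr_whiskr A B Y Z (f g : smap A B) (a : cell f g) (y : smap Y A) (z : smap Z Y) :
  carr (whiskr (whiskr a y) z) = carr (whiskr a (y ∘ z)).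
Proof.
rewrite !carr_whiskr (arr_fhom _ (carr_whiskr a y)) -arr_hmap_comp.
by apply: eq_arr_hmap; apply: smap_ext => n x; apply: smap_ext.
Qed.

Lemma whiskl_whiskr Z A B Y (u : smap A B) (f g : smap Z A) (a : cell f g) (y : smap Y Z) :
  carr (whiskr (whiskl u a) y) = carr (whiskl u (whiskr a y)).
Proof.
rewrite carr_whiskr carr_whiskl (arr_fhom _ (carr_whiskr a y)).
rewrite (arr_fhom _ (carr_whiskl u a)) -!arr_hmap_comp.
by apply: eq_arr_hmap; apply: smap_ext => n x; apply: smap_ext.
Qed.

Lemma whiskl_sid Z A (f g : smap Z A) (a : cell f g) : carr (whiskl (sid A) a) = carr a.
Proof.
rewrite carr_whiskl (@eq_arr_hmap _ _ _ (sid (exp Z A))) ?hmap_sid //.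
by apply: smap_ext => n x; apply: smap_ext.
Qed.

Lemma comp_map_subproof Z A B n (b : exp A B n) (a : exp Z A n)
    l m (d : delta l m) (x : (Z × Δ[n]) m) :
  b _ (a _ (act d x), (act d x).2) = act d (b _ (a _ x, x.2)).
Proof. by rewrite -smap_act /= -smap_act. Qed.

Lemma comp_map_act Z A B m n (d : delta m n) (x : (exp A B × exp Z A) n) :
  SMap (comp_map_subproof (act d x).1 (act d x).2) =
  act d (SMap (comp_map_subproof x.1 x.2) : exp Z B n).
Proof. by apply: smap_ext. Qed.

(** Internal composition B^A × A^Z → B^Z. An n-simplex is a family of maps parametrized by Δ[n], and
    both families are composed at the same parameter. *)
Definition comp_map Z A B : smap (exp A B × exp Z A) (exp Z B) :=
  @SMap (exp A B × exp Z A) (exp Z B) (fun n x => SMap (comp_map_subproof x.1 x.2))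
    (@comp_map_act Z A B).

(** This is [interchange] for [comp_map]: fixing a vertex [vtx w] in one variable turns internal
    composition into [postcomp] or [precomp] by [w]. *)
Lemma whisk_interchange Z A B (f g : smap A B) (h k : smap Z A)
    (a : cell f g) (b : cell h k) :
  cell_comp (whiskl g b) (whiskr a h) = cell_comp (whiskr a k) (whiskl f b).
Proof.
have whisklE (w : smap A B) : arr (homl (comp_map Z A B) (vtx w) b) = carr (whiskl w b).
  rewrite carr_whiskl arr_homl; apply: eq_arr_hmap.
  by apply: smap_ext => n x; apply: smap_ext.
have whiskrE (w : smap Z A) : arr (homr (comp_map Z A B) a (vtx w)) = carr (whiskr a w).
  rewrite carr_whiskr arr_homr; apply: eq_arr_hmap.
  by apply: smap_ext => n x; apply: smap_ext.
apply: carr_inj.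
have := congr1 (@arr (hcat (exp Z B)) _ _) (interchange (comp_map Z A B) a b).
rewrite (arr_comp (whisklE g) (whiskrE h)) (arr_comp (whiskrE k) (whisklE f)).
exact.
Qed.

End Cells.

(** * Transposition of 2-cells along an adjunction *)

Section Adjunction.
Variables (A B : sset) (f : smap B A) (u : smap A B).
Variables (eta : cell (sid B) (u ∘ f)) (eps : cell (f ∘ u) (sid A)).
Hypothesis adj : is_adjunction eta eps.

Definition unit_at Z (b : smap Z B) : cell b (u ∘ (f ∘ b)) :=
  cell_cast (scomp1s b) (esym (scompA u f b)) (whiskr eta b).

Definition counit_at Z (a : smap Z A) : cell (f ∘ (u ∘ a)) a :=
  cell_cast (esym (scompA f u a)) (scomp1s a) (whiskr eps a).

Lemma whiskr_unit_at Z Y (b : smap Z B) (y : smap Y Z) :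
  carr (whiskr (unit_at b) y) = carr (unit_at (b ∘ y)).
Proof. by rewrite (eq_carr_whiskr _ (carr_cast _ _ _)) whiskr_whiskr carr_cast. Qed.

(** Interchange of [eta] with [x]; the identity 1-cell on one side is absorbed by [whiskl_sid]. *)
Lemma unit_at_nat Z (b b' : smap Z B) (x : cell b b') :
  cell_comp (whiskl u (whiskl f x)) (unit_at b) = cell_comp (unit_at b') x.
Proof.
apply: carr_inj; have := congr1 (@carr _ _ _ _) (whisk_interchange eta x).
rewrite (carr_comp (a' := unit_at b) (b' := whiskl u (whiskl f x))); first last.
- by rewrite carr_cast.
- by rewrite whiskl_whiskl.
move->; apply: carr_comp; first by rewrite carr_cast.
exact: whiskl_sid.
Qed.

Lemma counit_at_nat Z (a a' : smap Z A) (x : cell a a') :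
  cell_comp x (counit_at a) = cell_comp (counit_at a') (whiskl f (whiskl u x)).
Proof.
apply: carr_inj; have := congr1 (@carr _ _ _ _) (whisk_interchange eps x).
rewrite (carr_comp (a' := counit_at a) (b' := x)); first last.
- by rewrite carr_cast.
- exact: whiskl_sid.
move->; apply: carr_comp; first by rewrite carr_cast.
by rewrite whiskl_whiskl.
Qed.

(** The triangle identity at [u], whiskered with [a]. *)
Lemma triangle_right Z (a : smap Z A) :
  cell_comp (whiskl u (counit_at a)) (unit_at (u ∘ a)) = cell_id (u ∘ a).
Proof.
apply: carr_inj; rewrite -whiskr_id -adj.1 whiskr_comp; apply: carr_comp.
- rewrite (eq_carr_whiskr _ (carr_cast _ _ _)) whiskl_whiskr.
  by apply: eq_carr_whiskl; rewrite carr_cast.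
- by rewrite (eq_carr_whiskr _ (carr_cast _ _ _)) whiskr_whiskr carr_cast.
Qed.

Lemma triangle_left Z (b : smap Z B) :
  cell_comp (counit_at (f ∘ b)) (whiskl f (unit_at b)) = cell_id (f ∘ b).
Proof.
apply: carr_inj; rewrite -whiskr_id -adj.2 whiskr_comp; apply: carr_comp.
- by rewrite (eq_carr_whiskr _ (carr_cast _ _ _)) whiskr_whiskr carr_cast.
- rewrite (eq_carr_whiskr _ (carr_cast _ _ _)) whiskl_whiskr.
  by apply: eq_carr_whiskl; rewrite carr_cast.
Qed.

(** The inverse transposition applies [f] and composes with the counit. Existence comes from
    naturality of the unit and the triangle at [u], uniqueness from naturality of the counit and the
    triangle at [f]. *)
Lemma unit_at_universal Z (b : smap Z B) (a : smap Z A) (x : cell b (u ∘ a)) :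
  exists! z : cell (f ∘ b) a, x = cell_comp (whiskl u z) (unit_at b).
Proof.
exists (cell_comp (counit_at a) (whiskl f x)); split.
- by rewrite whiskl_comp -cell_compA unit_at_nat cell_compA triangle_right cell_1comp.
- move=> z ->; rewrite whiskl_comp cell_compA -counit_at_nat -cell_compA.
  by rewrite triangle_left cell_comp1.
Qed.

End Adjunction.

(** * Limits as universal cones over a product with [X], and their preservation *)

Section TransposedLimit.
Variable X : sset.

Lemma pr_nat A K Y (l : smap K A) (y : smap Y K) :
  l ∘ sfst K X ∘ sprod_map y (sid X) = l ∘ y ∘ sfst Y X.
Proof. exact: smap_ext. Qed.

(** The restriction of the universal cone along [y], with its source cast so that a 2-cell whiskered
    by the projection composes with it. *)
Definition cone_at A K (l : smap K A) (k : smap (K × X) A) (L : cell (l ∘ sfst K X) k)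
    Y (y : smap Y K) : cell (l ∘ y ∘ sfst Y X) (k ∘ sprod_map y (sid X)) :=
  cell_cast (pr_nat l y) erefl (whiskr L (sprod_map y (sid X))).

(* The absolute lifting property through [const X A], with maps into A^X
   replaced by their transposes [K × X -> A]. *)
Definition is_transposed_limit A K (l : smap K A) (k : smap (K × X) A)
    (L : cell (l ∘ sfst K X) k) : Prop :=
  forall (Y : qcat) (b : smap Y A) (y : smap Y K)
    (x : cell (b ∘ sfst Y X) (k ∘ sprod_map y (sid X))),
  exists! z : cell b (l ∘ y), x = cell_comp (cone_at L y) (whiskr z (sfst Y X)).

Section RightAdjoint.
Variables (A B K : sset) (f : smap B A) (u : smap A B).
Variables (eta : cell (sid B) (u ∘ f)) (eps : cell (f ∘ u) (sid A)).
Hypothesis adj : is_adjunction eta eps.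

Lemma right_adjoint_transposed_limit (l : smap K A) (k : smap (K × X) A)
    (L : cell (l ∘ sfst K X) k) :
  is_transposed_limit L ->
  is_transposed_limit (cell_cast (scompA u l (sfst K X)) erefl (whiskl u L)).
Proof.
move=> limL Y b y x.
set uL := cell_cast _ _ _.
pose yX := sprod_map y (sid X).
(* [phi] is transposition for maps out of [Y], used on mediating cells; [psi] below is transposition
   for maps out of [Y × X], used on cones. Both are bijective by [unit_at_universal]. *)
pose phi (z : cell (f ∘ b) (l ∘ y)) : cell b (u ∘ l ∘ y) :=
  cell_cast erefl (scompA u l y) (cell_comp (whiskl u z) (unit_at eta b)).
have phiK (z' : cell b (u ∘ l ∘ y)) : exists! z, z' = phi z.
  have [z [zE zU]] :=
    unit_at_universal adj (cell_cast erefl (esym (scompA u l y)) z').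
  exists z; split.
    by apply: carr_inj; rewrite /phi carr_cast -zE carr_cast.
  by move=> w wE; apply: zU; apply: carr_inj; rewrite wE !carr_cast.
have unit_pr : carr (whiskr (unit_at eta b) (sfst Y X)) =
    carr (cell_cast erefl (congr1 (scomp u) (scompA f b (sfst Y X)))
      (unit_at eta (b ∘ sfst Y X))).
  by rewrite carr_cast whiskr_unit_at.
pose psi (w : cell (f ∘ b ∘ sfst Y X) (k ∘ yX)) : cell (b ∘ sfst Y X) (u ∘ k ∘ yX) :=
  cell_cast erefl (scompA u k yX) (cell_comp (whiskl u w)
    (cell_cast erefl (congr1 (scomp u) (scompA f b (sfst Y X)))
      (unit_at eta (b ∘ sfst Y X)))).
have psiK w' : exists! w, w' = psi w.
  have [w [wE wU]] :=
    unit_at_universal adj (cell_cast erefl (esym (scompA u k yX)) w').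
  have psiE v : carr (psi v) = carr (cell_comp (whiskl u
      (cell_cast (esym (scompA f b (sfst Y X))) erefl v)) (unit_at eta (b ∘ sfst Y X))).
    rewrite carr_cast; apply: carr_comp; last by rewrite carr_cast.
    by apply: eq_carr_whiskl; rewrite carr_cast.
  exists (cell_cast (scompA f b (sfst Y X)) erefl w); split.
    apply: carr_inj; rewrite psiE; move/(congr1 (@carr _ _ _ _)): wE.
    rewrite carr_cast => ->; apply: carr_comp => //.
    by apply: eq_carr_whiskl; rewrite !carr_cast.
  move=> v vE; apply: carr_inj.
  rewrite carr_cast (wU (cell_cast (esym (scompA f b (sfst Y X))) erefl v)) ?carr_cast //.
  by apply: carr_inj; rewrite carr_cast vE psiE.
(* Transposition commutes with forming cones: the cone for [uL] is [u] applied to the cone for [L],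
   and the unit at [b] whiskered with the projection is the unit at [b ∘ sfst Y X]. *)
have cone_phi z : cell_comp (cone_at uL y) (whiskr (phi z) (sfst Y X)) =
    psi (cell_comp (cone_at L y) (whiskr z (sfst Y X))).
  apply: carr_inj; rewrite carr_cast whiskl_comp -cell_compA; apply: carr_comp.
    rewrite carr_cast (eq_carr_whiskr _ (carr_cast _ _ _)) whiskl_whiskr.
    by apply: eq_carr_whiskl; rewrite carr_cast.
  rewrite (eq_carr_whiskr _ (carr_cast _ _ _)) whiskr_comp; apply: carr_comp => //.
  exact: whiskl_whiskr.
have [w [-> wU]] := psiK x; have [z [zE zU]] := limL _ _ _ w.
exists (phi z); split; first by rewrite cone_phi -zE.
(* Any other mediating cell is [phi z']. Injectivity of [psi], read off from uniqueness in
   [psiK (psi w)], shows that [z'] factors [w], hence equals [z]. *)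
move=> z1; have [z' [-> _]] := phiK z1; rewrite cone_phi => e.
congr phi; apply: zU.
have [v [_ vU]] := psiK (psi w).
by rewrite -(vU w erefl); apply: vU.
Qed.

End RightAdjoint.

(** * The exponential law on 1-cells and 2-cells *)

Lemma uncurry_act A Y (g : smap Y (exp X A)) m n (d : delta m n) (x : (Y × X) n) :
  g m (act d x.1) m (act d x.2, delta_id m) = act d (g n x.1 n (x.2, delta_id n)).
Proof.
rewrite smap_act /= -[RHS](smap_act (g n x.1 : smap (X × Δ[n]) A)) /=.
congr (smap_fun (g n x.1 : smap (X × Δ[n]) A) _); congr (_, _); exact: delta_ext.
Qed.

(** An n-simplex of A^X is a map X × Δ[n] → A; it is evaluated at the generic n-simplex
    [delta_id n]. *)
Definition uncurry A Y (g : smap Y (exp X A)) : smap (Y × X) A :=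
  SMap (uncurry_act g).

Lemma transposeK A Y (h : smap (Y × X) A) : uncurry (transpose h) = h.
Proof. by apply: smap_ext => n [y x] /=; rewrite act_id. Qed.

Lemma uncurryK A Y (g : smap Y (exp X A)) : transpose (uncurry g) = g.
Proof.
apply: smap_ext => n y; apply: smap_ext => m [x d] /=.
rewrite smap_act /=; congr (smap_fun (g n y : smap (X × Δ[n]) A) _); congr (_, _).
exact: delta_ext.
Qed.

Lemma uncurry_comp A Y Z (g : smap Y (exp X A)) (h : smap Z Y) :
  uncurry (g ∘ h) = uncurry g ∘ sprod_map h (sid X).
Proof. exact: smap_ext. Qed.

Lemma uncurry_postcomp A B Y (u : smap A B) (g : smap Y (exp X A)) :
  uncurry (postcomp X u ∘ g) = u ∘ uncurry g.
Proof. exact: smap_ext. Qed.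

Lemma uncurry_const A Y (g : smap Y A) : uncurry (const X A ∘ g) = g ∘ sfst Y X.
Proof. by apply: smap_ext => n x /=; rewrite act_id. Qed.

(** Uncurrying a map Y × Δ[n] → A^X puts the factor Δ[n] before X, whereas simplices of A^(Y × X)
    have it last. *)
Definition swap Y Z W : smap (Y × Z × W) (Y × W × Z) :=
  @SMap (Y × Z × W) (Y × W × Z) (fun _ x => (x.1.1, x.2, x.1.2)) (fun _ _ _ _ => erefl).

Lemma swapK Y Z W : swap Y Z W ∘ swap Y W Z = sid (Y × W × Z).
Proof. by apply: smap_ext => n [[y w] z]. Qed.

Lemma exp_uncurry_act A Y m n (d : delta m n) (g : exp Y (exp X A) n) :
  uncurry (act d g) ∘ swap Y X Δ[m] =
  act d (uncurry g ∘ swap Y X Δ[n] : exp (Y × X) A n).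
Proof. exact: smap_ext. Qed.

(** One half of the isomorphism (A^X)^Y ≅ A^(Y × X). As a simplicial map it has an image under
    [hmap], which transports 2-cells. *)
Definition exp_uncurry A Y : smap (exp Y (exp X A)) (exp (Y × X) A) :=
  @SMap (exp Y (exp X A)) (exp (Y × X) A) (fun n g => uncurry g ∘ swap Y X Δ[n])
    (@exp_uncurry_act A Y).

Lemma exp_curry_act A Y m n (d : delta m n) (h : exp (Y × X) A n) :
  transpose (act d h ∘ swap Y Δ[m] X) =
  act d (transpose (h ∘ swap Y Δ[n] X) : exp Y (exp X A) n).
Proof. by apply: smap_ext => k y; apply: smap_ext => l x. Qed.

Definition exp_curry A Y : smap (exp (Y × X) A) (exp Y (exp X A)) :=
  @SMap (exp (Y × X) A) (exp Y (exp X A)) (fun n h => transpose (h ∘ swap Y Δ[n] X))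
    (@exp_curry_act A Y).

Lemma exp_uncurryK A Y : exp_curry A Y ∘ exp_uncurry A Y = sid _.
Proof. by apply: smap_ext => n g /=; rewrite -scompA swapK scomps1 uncurryK. Qed.

Lemma exp_curryK A Y : exp_uncurry A Y ∘ exp_curry A Y = sid _.
Proof. by apply: smap_ext => n g /=; rewrite transposeK -scompA swapK scomps1. Qed.

Lemma vtx_uncurry A Y (g : smap Y (exp X A)) :
  exp_uncurry A Y 0 (vtx g) = vtx (uncurry g).
Proof. exact: smap_ext. Qed.

Lemma vtx_curry A Y (g : smap Y (exp X A)) :
  exp_curry A Y 0 (vtx (uncurry g)) = vtx g.
Proof. by rewrite -vtx_uncurry -[LHS]/((_ ∘ _) 0 _) exp_uncurryK. Qed.

Definition cell_uncurry A Y (g h : smap Y (exp X A)) (a : cell g h) :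
    cell (uncurry g) (uncurry h) :=
  @hom_cast (hcat (exp (Y × X) A)) _ _ _ _ (vtx_uncurry g) (vtx_uncurry h)
    (fhom (hmap (exp_uncurry A Y)) a).

Definition cell_curry A Y (g h : smap Y (exp X A)) (a : cell (uncurry g) (uncurry h)) :
    cell g h :=
  @hom_cast (hcat (exp Y (exp X A))) _ _ _ _ (vtx_curry g) (vtx_curry h)
    (fhom (hmap (exp_curry A Y)) a).

Lemma carr_uncurry A Y (g h : smap Y (exp X A)) (a : cell g h) :
  carr (cell_uncurry a) = arr (fhom (hmap (exp_uncurry A Y)) a).
Proof. exact: (@arr_cast (hcat (exp (Y × X) A))). Qed.

Lemma carr_curry A Y (g h : smap Y (exp X A)) (a : cell (uncurry g) (uncurry h)) :
  carr (cell_curry a) = arr (fhom (hmap (exp_curry A Y)) a).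
Proof. exact: (@arr_cast (hcat (exp Y (exp X A)))). Qed.

Lemma eq_carr_uncurry A Y (g h g' h' : smap Y (exp X A)) (a : cell g h) (a' : cell g' h') :
  carr a = carr a' -> carr (cell_uncurry a) = carr (cell_uncurry a').
Proof. by rewrite !carr_uncurry; apply: arr_fhom. Qed.

Lemma cell_uncurryK A Y (g h : smap Y (exp X A)) (a : cell g h) :
  cell_curry (cell_uncurry a) = a.
Proof.
apply: carr_inj; rewrite carr_curry (arr_fhom _ (carr_uncurry a)) -arr_hmap_comp.
by rewrite exp_uncurryK hmap_sid.
Qed.

Lemma cell_curryK A Y (g h : smap Y (exp X A)) (a : cell (uncurry g) (uncurry h)) :
  cell_uncurry (cell_curry a) = a.
Proof.
apply: carr_inj; rewrite carr_uncurry (arr_fhom _ (carr_curry a)) -arr_hmap_comp.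
by rewrite exp_curryK hmap_sid.
Qed.

Lemma cell_uncurry_comp A Y (g h k : smap Y (exp X A)) (b : cell h k) (a : cell g h) :
  cell_uncurry (cell_comp b a) = cell_comp (cell_uncurry b) (cell_uncurry a).
Proof.
by rewrite /cell_uncurry fhom_comp; apply: (@hom_cast_comp (hcat (exp (Y × X) A))).
Qed.

Lemma cell_uncurry_whiskl A B Y (u : smap A B) (g h : smap Y (exp X A)) (a : cell g h) :
  carr (cell_uncurry (whiskl (postcomp X u) a)) = carr (whiskl u (cell_uncurry a)).
Proof.
rewrite carr_uncurry carr_whiskl (arr_fhom _ (carr_whiskl _ a)).
rewrite (arr_fhom _ (carr_uncurry a)) -!arr_hmap_comp.
by apply: eq_arr_hmap; apply: smap_ext => n x; apply: smap_ext.
Qed.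

Lemma cell_uncurry_whiskr A Y Z (g h : smap Y (exp X A)) (a : cell g h) (y : smap Z Y) :
  carr (cell_uncurry (whiskr a y)) = carr (whiskr (cell_uncurry a) (sprod_map y (sid X))).
Proof.
rewrite carr_uncurry carr_whiskr (arr_fhom _ (carr_whiskr a y)).
rewrite (arr_fhom _ (carr_uncurry a)) -!arr_hmap_comp.
by apply: eq_arr_hmap; apply: smap_ext => n x; apply: smap_ext.
Qed.

(** Composing with the constant diagram functor and then uncurrying is precomposition with the
    projection, as simplicial maps A^Y → A^(Y × X). *)
Lemma cell_uncurry_const A Y (g h : smap Y A) (a : cell g h) :
  carr (cell_uncurry (whiskl (const X A) a)) = carr (whiskr a (sfst Y X)).
Proof.
rewrite carr_uncurry carr_whiskr (arr_fhom _ (carr_whiskl _ a)) -arr_hmap_comp.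
apply: eq_arr_hmap; apply: smap_ext => n x; apply: smap_ext => m y /=.
by rewrite act_id.
Qed.

(** Uncurrying is bijective on 2-cells and respects composition and whiskering, so the two universal
    properties correspond. Leaving [k'] and [a'] free up to equality lets the transposed data be
    given in any convenient form. *)
Lemma absolute_right_lifting_constE A K (l : smap K A) (k : smap K (exp X A))
    (a : cell (const X A ∘ l) k) (k' : smap (K × X) A) (a' : cell (l ∘ sfst K X) k') :
  uncurry k = k' -> carr (cell_uncurry a) = carr a' ->
  is_absolute_right_lifting (const X A) k l a <-> is_transposed_limit a'.
Proof.
move=> kk'; subst k' => aa'.
(* The factorization equation is equivalent to its transpose with the same [z], since [z] is a
   2-cell between maps into [A] and is not itself transposed. *)
have eq_cell Y (b : smap Y A) (y : smap Y K) (x : cell (const X A ∘ b) (k ∘ y)) z :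
    x = cell_comp (whiskr a y) (cell_cast erefl (scompA _ l y) (whiskl (const X A) z)) <->
    cell_cast (uncurry_const b) (uncurry_comp k y) (cell_uncurry x) =
    cell_comp (cone_at a' y) (whiskr z (sfst Y X)).
  have uE : carr (cell_uncurry (cell_comp (whiskr a y)
      (cell_cast erefl (scompA _ l y) (whiskl (const X A) z)))) =
      carr (cell_comp (cone_at a' y) (whiskr z (sfst Y X))).
    rewrite cell_uncurry_comp; apply: carr_comp.
      by rewrite cell_uncurry_whiskr carr_cast; apply: eq_carr_whiskr.
    by rewrite (eq_carr_uncurry (carr_cast _ _ _)) cell_uncurry_const.
  split=> [->|e]; first by apply: carr_inj; rewrite carr_cast uE.
  rewrite -[LHS]cell_uncurryK -[RHS]cell_uncurryK; congr cell_curry.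
  by apply: carr_inj; rewrite uE -e carr_cast.
split=> ha Y b y x.
- have [z [zE zU]] := ha Y b y (cell_curry
    (cell_cast (esym (uncurry_const b)) (esym (uncurry_comp k y)) x)).
  (* Here the cone is given on the transposed side; it is written as the transpose of a curried cell
     so that [eq_cell] applies. *)
  have xE : x = cell_cast (uncurry_const b) (uncurry_comp k y) (cell_uncurry (cell_curry
      (cell_cast (esym (uncurry_const b)) (esym (uncurry_comp k y)) x))).
    by apply: carr_inj; rewrite carr_cast cell_curryK carr_cast.
  exists z; split; first by rewrite {1}xE; apply/eq_cell.
  by move=> w wE; apply: zU; apply/eq_cell; rewrite -xE.
- have [z [zE zU]] := ha Y b y
    (cell_cast (uncurry_const b) (uncurry_comp k y) (cell_uncurry x)).
  by exists z; split=> [|w /eq_cell]; [apply/eq_cell | apply: zU].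
Qed.

End TransposedLimit.

Theorem proposition5p2p13 (A B K : qcat) (X : sset) (u : smap A B)
    (hu : has_left_adjoint u) (k : smap K (exp X A)) (lim : smap K A)
    (lambda : cell (const X A ∘ lim) k)
    (hlim : is_absolute_right_lifting (const X A) k lim lambda) :
  is_absolute_right_lifting (const X B) (postcomp X u ∘ k) (u ∘ lim)
    (cell_cast (postcomp_const X u lim) (erefl (postcomp X u ∘ k))
       (whiskl (postcomp X u) lambda)).
Proof.
have [f [eta [eps adj]]] := hu.
pose L := cell_cast (uncurry_const X lim) erefl (cell_uncurry lambda).
have limL : is_transposed_limit L.
  by apply: (iffLR (absolute_right_lifting_constE _ _) hlim); rewrite ?carr_cast.
have uL := right_adjoint_transposed_limit adj limL.
(* It remains to see that the transpose of [u^X] whiskered with [lambda] is [u] whiskered with the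
   transpose of [lambda]. *)
apply: (iffRL (absolute_right_lifting_constE (uncurry_postcomp u k) _) uL).
rewrite (eq_carr_uncurry (carr_cast _ _ _)) cell_uncurry_whiskl carr_cast.
by apply: eq_carr_whiskl; rewrite carr_cast.
Qed.
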